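(* Let $X$ be a finite-dimensional Banach space over $\mathbb{F}$ ($\mathbb{F}=\mathbb{R}$ or $\mathbb{C}$) for which the numerical radius $w(\cdot)$ is a norm on $\mathcal{L}(X)$. Then $$E_{\mathcal{L}(X)_w^*}\subseteq\{x^*\otimes x : x^*\in E_{X^*},\ x\in E_X,\ |x^*(x)|=1\}.$$
   Context: For a Banach space $X$ over $\mathbb{F}\in\{\mathbb{R},\mathbb{C}\}$, $X^*$ is its dual, $S_X$ its unit sphere, $B_X$ its closed unit ball. For any normed space $Y$ (in particular $X$, $X^*$ and $\mathcal{L}(X)_w^*$), $E_Y$ denotes the set of all extreme points of the closed unit ball $B_Y$. $\mathcal{L}(X)$ is the space of bounded linear operators on $X$. The numerical radius of $T\in\mathcal{L}(X)$ is $w(T)=\sup\{|x^*(Tx)| : x^*\in S_{X^*},\ x\in S_X,\ x^*(x)=1\}$; only spaces $X$ for which $w(\cdot)$ is a norm on $\mathcal{L}(X)$ are considered. $\mathcal{L}(X)_w$ denotes $\mathcal{L}(X)$ with the norm $w(\cdot)$, and $\mathcal{L}(X)_w^*$ is its dual. For $x\in X$, $x^*\in X^*$, $x^*\otimes x$ is the linear functional on $\mathcal{L}(X)_w$ given by $(x^*\otimes x)(T)=x^*(Tx)$. *)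

(* Defs.v *)
From HB Require Import structures.
From mathcomp Require Import all_boot all_order all_algebra.
From mathcomp Require Import boolp classical_sets functions reals topology.
From mathcomp Require Import normedtype.
From mathcomp Require Export complex.

Set Implicit Arguments.
Unset Strict Implicit.
Unset Printing Implicit Defensive.

Import Order.TTheory GRing.Theory Num.Theory.
Import numFieldNormedType.Exports.

Local Open Scope classical_set_scope.
Local Open Scope ring_scope.

Section bounded_operators.
Variables (K : numFieldType) (U V : normedModType K).

Definition is_bounded_linear (f : U -> V) : Prop :=
  linear f /\ exists M : K, forall x, `|f x| <= M * `|x|.

Definition bounded_linear_pred : {pred U -> V} :=
  mem [set f | is_bounded_linear f].

Lemma bounded_linear_submod : submod_closed bounded_linear_pred.
Proof.
split.
  rewrite inE; split=> [a x y|]; first by rewrite /= scaler0 addr0.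
  by exists 0 => x; rewrite mul0r normr0.
move=> a f g; rewrite !inE => -[fl [M fM]] [gl [N gN]]; split.
  move=> b x y; rewrite !fctE fl gl /= !scalerDr !scalerA [b * a]mulrC.
  by rewrite addrACA.
exists (`|a| * M + N) => x; rewrite !fctE mulrDl (le_trans (ler_normD _ _))//.
by rewrite lerD// normrZ -mulrA ler_wpM2l.
Qed.

HB.instance Definition _ :=
  GRing.isSubmodClosed.Build K (U -> V) bounded_linear_pred
    bounded_linear_submod.

Record bounded_linear : Type := BoundedLinear {
  bounded_linear_fun :> U -> V;
  bounded_linearP : bounded_linear_fun \in bounded_linear_pred }.

HB.instance Definition _ := [isSub for bounded_linear_fun].
HB.instance Definition _ := [Choice of bounded_linear by <:].
HB.instance Definition _ := [SubChoice_isSubLmodule of bounded_linear by <:].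

(* Suprema are taken in [K] itself, as norms are [K]-valued in the library: when
   [K] is [R[i]] a nonempty bounded set of nonnegative reals has the usual
   supremum as least upper bound for the partial order of [R[i]]. *)
Definition opnorm (f : bounded_linear) : K :=
  supremum 0 [set `|f x| | x in [set x : U | `|x| <= 1]].

End bounded_operators.

Definition dual (K : numFieldType) (X : normedModType K) :=
  bounded_linear X K^o.

Definition endo (K : numFieldType) (X : normedModType K) :=
  bounded_linear X X.

HB.instance Definition _ K X := GRing.Lmodule.on (@dual K X).
HB.instance Definition _ K X := GRing.Lmodule.on (@endo K X).

Definition extreme_points (K : numFieldType) (V : lmodType K) (A : set V) :
    set V :=
  [set x | A x /\ forall y z (t : K), A y -> A z -> 0 < t < 1 ->
             x = t *: y + (1 - t) *: z -> y = x /\ z = x].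

Definition ball_extreme (K : numFieldType) (X : normedModType K) : set X :=
  extreme_points [set x | `|x| <= 1].

Definition dual_ball_extreme (K : numFieldType) (X : normedModType K) :
    set (dual X) :=
  extreme_points [set f : dual X | opnorm f <= 1].

Section numerical_radius.
Variables (K : numFieldType) (X : normedModType K).

Definition numerical_radius (T : endo X) : K :=
  supremum 0 [set r | exists (f : dual X) (x : X),
    [/\ opnorm f = 1, `|x| = 1, f x = 1 & r = `|f (T x)|]].

End numerical_radius.

Definition is_norm (K : numFieldType) (V : lmodType K) (N : V -> K) : Prop :=
  [/\ forall u v, N (u + v) <= N u + N v,
      forall (a : K) v, N (a *: v) = `|a| * N v &
      forall v, N v = 0 -> v = 0].

(* [endo X] renormed by the numerical radius. *)
Definition endo_w (K : numFieldType) (X : normedModType K)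
  (wN : is_norm (@numerical_radius K X)) : Type := endo X.

Section endo_w.
Variables (K : numFieldType) (X : normedModType K).
Variable wN : is_norm (@numerical_radius K X).

HB.instance Definition _ := GRing.Lmodule.on (endo_w wN).

Let normD (S T : endo_w wN) :
  numerical_radius (S + T) <= numerical_radius S + numerical_radius T.
Proof. by have [H _ _] := wN; exact: H. Qed.

Let normZ (a : K) (T : endo_w wN) :
  numerical_radius (a *: T) = `|a| * numerical_radius T.
Proof. by have [_ H _] := wN; exact: H. Qed.

Let norm0 (T : endo_w wN) : numerical_radius T = 0 -> T = 0.
Proof. by have [_ _ H] := wN; exact: H. Qed.

HB.instance Definition _ :=
  @Lmodule_isNormed.Build K (endo_w wN) (@numerical_radius K X) normD normZ
    norm0.

End endo_w.

Definition tensor (K : numFieldType) (X : normedModType K) (f : dual X)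
  (x : X) : endo X -> K := fun T => f (T x).

Definition finite_dimensional (K : numFieldType) (X : lmodType K) : Prop :=
  exists (n : nat) (e : 'I_n -> X),
    forall x, exists c : 'I_n -> K, x = \sum_(i < n) c i *: e i.

(* Main.v *)
(* The unit ball of the dual of [endo X] for the numerical radius norm is the
   closed convex hull of the tensors [f \otimes x] with [f] and [x] in the unit
   balls and [|f x| = 1], since [w T] is the supremum of [|f (T x)|] over them.
   In finite dimension these tensors form a compact set, so Milman's converse of
   the Krein-Milman theorem shows that every extreme functional is such a tensor;
   both factors inherit extremality. All spaces of functionals carry the topology
   of pointwise convergence, where compactness comes from Tychonoff's theorem. *)
Require Import Defs.
From HB Require Import structures.
From mathcomp Require Import all_boot all_order all_algebra.
From mathcomp Require Import boolp classical_sets functions reals topology.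
From mathcomp Require Import normedtype derive realfun.
From mathcomp Require Import complex ring lra.

Set Implicit Arguments.
Unset Strict Implicit.
Unset Printing Implicit Defensive.

Import Order.TTheory GRing.Theory Num.Theory.
Import numFieldNormedType.Exports.

Local Open Scope classical_set_scope.
Local Open Scope ring_scope.

(** The convexity argument sees functionals only through their real parts, as points of a product of
    copies of [R]; a linear functional is recovered from its real part, so one real separation
    argument serves both fields. The separating functional is a finite combination of evaluations,
    hence evaluation at a single operator [S]: the bound it gives on the tensors at [S] is a bound
    on the numerical radius of [S]. Finite dimension acts twice: it makes the tensors compact, and
    it supplies the rank-one operators that tell the factors apart. *)

(** Finite subcovers as an induction principle: if [Q A] failed, the sets [C] such that [Q] holds of
    [A] minus [C] would form a proper filter, and a cluster point of it in [A] would contradict the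
    local hypothesis. *)
Lemma compact_ind (T : topologicalType) (A : set T) (Q : set T -> Prop) :
  Q set0 -> (forall B C, B `<=` C -> Q C -> Q B) ->
  (forall B C, Q B -> Q C -> Q (B `|` C)) ->
  (forall x, A x -> exists2 U, nbhs x U & Q (A `&` U)) ->
  compact A -> Q A.
Proof.
move=> Q0 Qsub QU Qloc cA; apply: contrapT => nQA.
pose F := [set C | Q (A `\` C)].
have FF : ProperFilter F.
  apply: Build_ProperFilter; first by rewrite /F/= setD0.
  split=> [|B C QB QC|B C BC QB]; rewrite /F/=.
  - by rewrite setDT.
  - by rewrite setDIr; exact: QU.
  - by apply: Qsub QB; exact: setDS.
have [|x [Ax clx]] := cA F FF; first by rewrite /F/= setDv.
have [U xU QAU] := Qloc x Ax.
have [|y []] := clx (~` U) U _ xU; first by rewrite /F/= setDE setCK.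
by [].
Qed.

Section pointwise_operations.
Context {K : numFieldType} {T : topologicalType}.
Implicit Types f g : T -> K^o.

(* [cvgD], [cvgB] and [cvgM] are stated for [f + g], [f - g] and [f \* g]; when
   [T] is itself a space of functions, their unification with applied arguments
   does not terminate. *)
Lemma continuous_addr f g : continuous f -> continuous g ->
  continuous (fun t => f t + g t : K^o).
Proof. by move=> cf cg t; apply: cvgD; [exact: cf|exact: cg]. Qed.

Lemma continuous_subr f g : continuous f -> continuous g ->
  continuous (fun t => f t - g t : K^o).
Proof. by move=> cf cg t; apply: cvgB; [exact: cf|exact: cg]. Qed.

Lemma continuous_mulr f g : continuous f -> continuous g ->
  continuous (fun t => f t * g t : K^o).
Proof. by move=> cf cg t; apply: cvgM; [exact: cf|exact: cg]. Qed.

End pointwise_operations.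

(** * Compact convex sets of real functions, separation and Milman's theorem *)

Section Milman.
Context {R : realType} {I : choiceType}.
Let E := {ptws I -> R}.
Implicit Types (A B D G : set E) (a b d : E).

Definition mix (t : R) a b : E := fun i => t * a i + (1 - t) * b i.

Definition convex A :=
  forall t a b, 0 <= t <= 1 -> A a -> A b -> A (mix t a b).

Definition join A B : set E :=
  [set d | exists t a b, [/\ 0 <= t <= 1, A a, B b & d = mix t a b]].

Lemma mix1 a b : mix 1 a b = a.
Proof. by apply/funext => i; rewrite /mix; ring. Qed.

Lemma mix0 a b : mix 0 a b = b.
Proof. by apply/funext => i; rewrite /mix; ring. Qed.

Lemma join_subl A B b : B b -> A `<=` join A B.
Proof. by move=> Bb a Aa; exists 1, a, b; rewrite ler01 lexx mix1. Qed.

Lemma join_subr A B a : A a -> B `<=` join A B.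
Proof. by move=> Aa b Bb; exists 0, a, b; rewrite ler01 lexx mix0. Qed.

(** The weights are not normalised, so that [u + v] may vanish; any point of [A] then serves as [c].
    This lets [convex_join] regroup a mixture of mixtures without dividing. *)
Lemma convex_weights A a b (u v : R) : convex A -> A a -> A b ->
  0 <= u -> 0 <= v -> exists2 c, A c & forall i, u * a i + v * b i = (u + v) * c i.
Proof.
move=> cA Aa Ab u0 v0; have [uv0|uv0] := eqVneq (u + v) 0.
  exists a => // i.
  have [-> ->] : u = 0 /\ v = 0 by split; lra.
  ring.
have uv : 0 < u + v by rewrite lt_def uv0 addr_ge0.
exists (mix (u / (u + v)) a b).
  apply: cA => //; rewrite divr_ge0 ?(ltW uv)//= ler_pdivrMr// mul1r.
  by rewrite lerDl.
by move=> i; rewrite /mix; field.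
Qed.

Lemma convex_join A B : convex A -> convex B -> convex (join A B).
Proof.
move=> cA cB t _ _ /andP[t0 t1] [s [a [b [/andP[s0 s1] Aa Bb ->]]]]
  [r [a' [b' [/andP[r0 r1] Aa' Bb' ->]]]].
have [||c Ac ac] := convex_weights (u := t * s) (v := (1 - t) * r) cA Aa Aa'.
- by rewrite mulr_ge0.
- by rewrite mulr_ge0// subr_ge0.
have [||d Bd bd] :=
  convex_weights (u := t * (1 - s)) (v := (1 - t) * (1 - r)) cB Bb Bb'.
- by rewrite mulr_ge0// subr_ge0.
- by rewrite mulr_ge0// subr_ge0.
exists (t * s + (1 - t) * r), c, d; split => //.
  by apply/andP; split; nra.
have e : 1 - (t * s + (1 - t) * r) = t * (1 - s) + (1 - t) * (1 - r) by ring.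
by apply/funext => i; rewrite /mix e -ac -bd; ring.
Qed.

Lemma ptws_continuous (T : topologicalType) (Y : topologicalType) (J : choiceType)
  (f : T -> {ptws J -> Y}) :
  (forall i, continuous (fun x => f x i)) -> continuous f.
Proof.
move=> cf x; apply/cvg_sup => i; move: x.
apply/(@continuousP _ (initial_topology (@^~ i))) => _ [B oB <-].
by rewrite -comp_preimage; apply: open_comp => // x _; exact: cf.
Qed.

Lemma eval_continuous (Y : topologicalType) (J : choiceType) (i : J) :
  continuous (fun f : {ptws J -> Y} => f i).
Proof. exact: (@proj_continuous J (fun=> Y) i). Qed.

Lemma compact_join A B : compact A -> compact B -> compact (join A B).
Proof.
move=> cA cB.
have -> : join A B = (fun p : R * (E * E) => mix p.1 p.2.1 p.2.2) @`
    (`[0, 1]%classic `*` (A `*` B)).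
  apply/seteqP; split => [_ [t [a [b [t01 Aa Bb ->]]]]|
    _ [[t [a b]] /= [t01 [Aa Bb]] <-]].
    by exists (t, (a, b)) => //=; split => //=; rewrite in_itv.
  by exists t, a, b; split=> //; move: t01; rewrite in_itv.
apply: continuous_compact; last first.
  apply: compact_setX; first exact: segment_compact.
  exact: compact_setX.
apply: continuous_subspaceT; apply: ptws_continuous => i [t [a b]].
rewrite /mix/=; apply: cvgD; apply: cvgM.
- exact: cvg_fst.
- apply: (cvg_comp (fun p : R * (E * E) => p.2.1) (fun f : E => f i)).
    apply: cvg_comp; [exact: cvg_snd|exact: cvg_fst].
  exact: eval_continuous.
- by apply: cvgB; [exact: cvg_cst|exact: cvg_fst].
- apply: (cvg_comp (fun p : R * (E * E) => p.2.2) (fun f : E => f i)).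
    apply: cvg_comp; [exact: cvg_snd|exact: cvg_snd].
  exact: eval_continuous.
Qed.


(** By compactness, finitely many coordinates [s] distinguish [phi] from all of [D]. In these
    coordinates the point [d0] of [D] nearest to [phi] yields the normal [phi - d0], with the
    squared distance [h d0] as gap. *)
Lemma separation D phi : compact D -> convex D -> ~ D phi ->
  exists (s : seq I) (c : I -> R) (e : R), 0 < e /\
    forall d, D d -> \sum_(i <- s) c i * d i + e <= \sum_(i <- s) c i * phi i.
Proof.
move=> kD cD nDphi.
have [D0|[d1 Dd1]] : D = set0 \/ exists d, D d.
- by have [->|/set0P] := eqVneq D set0; [left|right].
- by exists [::], (fun=> 0), 1; rewrite ltr01 D0.
have [s sP] : exists s : seq I,
    forall d, D d -> exists2 i, i \in s & d i != phi i.
  pose Q (A : set E) := exists s : seq I,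
    forall d, A d -> exists2 i, i \in s & d i != phi i.
  apply: (@compact_ind _ D Q) => //.
  - by exists [::].
  - by move=> B C BC [s sP]; exists s => d /BC; exact: sP.
  - move=> B C [s sP] [t tP]; exists (s ++ t) => d [/sP|/tP] [i si di];
      by exists i => //; rewrite mem_cat si ?orbT.
  - move=> d Dd; have [i di] : exists i, d i != phi i.
      apply: contrapT => /forallNP ephi; apply: nDphi.
      suff -> : phi = d by [].
      by apply/funext => i; apply/esym/eqP/negPn/negP/ephi.
    exists [set f : E | f i != phi i].
      apply: (@eval_continuous R I i d [set x | x != phi i]).
      by apply: open_nbhs_nbhs; split => //; exact: open_neq.
    by exists [:: i] => f [_ fi]; exists i; rewrite ?inE.
pose h (d : E) := \sum_(i <- s) (d i - phi i) ^+ 2.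
have ch : continuous h.
  apply: continuous_big => [|i _]; first exact: add_continuous.
  move=> d; apply: (@cvg_comp _ _ _ (fun f : E => f i - phi i)
    (fun x => x ^+ 2) (nbhs d) (nbhs (d i - phi i))); last exact: exprn_continuous.
  by apply: cvgB; [exact: eval_continuous|exact: cst_continuous].
have [|d0 /set_mem Dd0 hmin] := @compact_EVT_min E R h D (ex_intro _ d1 Dd1) kD.
  exact: continuous_subspaceT.
exists s, (fun i => phi i - d0 i), (h d0); split.
  have [i si di] := sP _ Dd0.
  rewrite /h (big_rem i si)/= ltr_pwDl//; last first.
    by apply: sumr_ge0 => j _; exact: sqr_ge0.
  by rewrite exprn_even_gt0//= subr_eq0.
move=> d Dd.
pose P := \sum_(i <- s) (d0 i - phi i) * (d i - d0 i).
pose N := \sum_(i <- s) (d i - d0 i) ^+ 2.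
have N0 : 0 <= N by apply: sumr_ge0 => i _; exact: sqr_ge0.
(* Along the segment from [d0] to [d], [P] is half the initial slope of [h]; minimality of [d0]
   forces it to be nonnegative. *)
have hmix t : h (mix t d d0) = h d0 + 2 * t * P + t ^+ 2 * N.
  rewrite /h /P /N !mulr_sumr -!big_split/=; apply: eq_bigr => i _.
  by rewrite /mix; ring.
have P0 : 0 <= P.
  rewrite leNgt; apply/negP => P0.
  have NP : 0 < N - P by lra.
  (* The vertex [- P / N] of the parabola could exceed 1. The present [t] lies in []0, 1]] and gives
     [2 * P + t * N = (1 + t) * P], which is negative. *)
  pose t := - P / (N - P).
  have t0 : 0 < t by rewrite divr_gt0// oppr_gt0.
  have tNP : t * (N - P) = - P by rewrite /t divfK// gt_eqF.
  have t1 : t <= 1 by rewrite ler_pdivrMr//; lra.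
  have /hmin : mix t d d0 \in D.
    by apply/mem_set; apply: cD => //; rewrite (ltW t0).
  rewrite hmix; apply/negP; rewrite -ltNge.
  have -> : h d0 + 2 * t * P + t ^+ 2 * N = h d0 + t * (2 * P + t * N) by ring.
  by have : t * (2 * P + t * N) < 0; [nra|lra].
rewrite -subr_ge0 (_ : _ - _ = P)// opprD addrA -sumrB -sumrB.
by apply: eq_bigr => i _; ring.
Qed.

Lemma convex_slab i (l u : R) : convex [set d | l <= d i <= u].
Proof.
move=> t a b /andP[t0 t1] /= /andP[la au] /andP[lb bu].
by rewrite /mix; apply/andP; split; nra.
Qed.

Lemma closed_slab i (l u : R) : closed [set d : E | l <= d i <= u].
Proof.
have -> : [set d : E | l <= d i <= u] = (fun d : E => d i) @^-1` `[l, u]%classic.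
  by apply/seteqP; split => d /=; rewrite in_itv.
apply: closed_comp; last exact: interval_closed.
by move=> d _; exact: eval_continuous.
Qed.

(* Milman's partial converse of the Krein-Milman theorem: the convex compact
   subsets of [B] missing [phi] are directed because [phi] is extreme, and the
   slabs of [B] around the points of [G] belong to this family, so one member
   [D] contains [G]; separate [phi] from [D]. *)
Lemma extreme_separation B G phi :
  compact B -> convex B -> compact G -> G `<=` B -> ~ G phi ->
  (forall t a b, 0 < t < 1 -> B a -> B b -> phi = mix t a b -> a = phi) ->
  exists (s : seq I) (c : I -> R) (e : R), 0 < e /\
    forall d, G d -> \sum_(i <- s) c i * d i + e <= \sum_(i <- s) c i * phi i.
Proof.
move=> kB cB kG GB nGphi extr.
pose good D := [/\ compact D, convex D, D `<=` B & ~ D phi].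
have [D [[kD cD DB nDphi] GD]] : exists D, good D /\ G `<=` D.
  pose Q (A : set E) := exists D, good D /\ A `<=` D.
  apply: (@compact_ind _ G Q) => //.
  - by exists set0; split => //; split => //; exact: compact0.
  - by move=> A C AC [D [gD CD]]; exists D; split => //; exact: subset_trans CD.
  - move=> A C [D1 [gD1 AD1]] [D2 [gD2 CD2]].
    (* A join with an empty set is empty and would lose the other set, so empty members are treated
       apart. *)
    have [D10|/set0P[a Da]] := eqVneq D1 set0.
      by exists D2; split => // x [/AD1|/CD2//]; rewrite D10.
    have [D20|/set0P[b Db]] := eqVneq D2 set0.
      by exists D1; split => // x [/AD1//|/CD2]; rewrite D20.
    move: gD1 gD2 => [k1 c1 D1B n1] [k2 c2 D2B n2].
    exists (join D1 D2); split; last first.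
      by move=> x [/AD1|/CD2]; [exact: join_subl Db _|exact: join_subr Da _].
    split; [exact: compact_join|exact: convex_join| |].
      by move=> _ [t [x [y [t01 /D1B Bx /D2B By ->]]]]; exact: cB.
    move=> [t [x [y [/andP[t0 t1] D1x D2y phiE]]]].
    have [t00|tn0] := eqVneq t 0; first by apply: n2; rewrite phiE t00 mix0.
    have [t11|tn1] := eqVneq t 1; first by apply: n1; rewrite phiE t11 mix1.
    apply: n1; rewrite -(extr t x y _ (D1B _ D1x) (D2B _ D2y) phiE)//.
    by rewrite lt_def tn0 t0 lt_def eq_sym tn1.
  - move=> g Gg; have [i gi] : exists i, g i != phi i.
      apply: contrapT => /forallNP ephi; apply: nGphi.
      suff -> : phi = g by [].
      by apply/funext => i; apply/esym/eqP/negPn/negP/ephi.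
    (* Half the gap at coordinate [i], so that the closed slab around [g] still excludes [phi]. *)
    pose r := `|g i - phi i| / 2.
    have r0 : 0 < r by rewrite divr_gt0// normr_gt0 subr_eq0.
    pose S : set E := [set d | g i - r <= d i <= g i + r].
    exists S.
      apply: (@eval_continuous R I i g [set x | g i - r <= x <= g i + r]).
      have := @nbhsx_ballx R R^o (g i) r r0; apply: filterS => x.
      by rewrite /ball/= => /ltW; rewrite distrC ler_distl.
    exists (B `&` S); split => [|x [Gx Sx]]; last by split => //; exact: GB.
    split.
    + by apply: compact_closedI => //; exact: closed_slab.
    + by move=> t x y t01 [Bx Sx] [By Sy]; split; [exact: cB|exact: convex_slab].
    + by move=> x [].
    + move=> [_]; rewrite /S/= -ler_distl distrC => rle.
      by move: r0 rle; rewrite /r; lra.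
have [s [c [e [e0 sep]]]] := separation kD cD nDphi.
by exists s, c, e; split => // d /GD; exact: sep.
Qed.
End Milman.

(** * Bounded linear maps, scalars and operator norms *)

Section bounded_linear_theory.
Context {K : numFieldType} {U V : normedModType K}.
Implicit Types f g : bounded_linear U V.

Lemma bounded_linear_is_linear f : linear f.
Proof. by have := bounded_linearP f; rewrite inE => -[]. Qed.

Lemma bounded_linearPZ f a x y : f (a *: x + y) = a *: f x + f y.
Proof. exact: bounded_linear_is_linear. Qed.

Lemma bounded_linear0 f : f 0 = 0.
Proof.
have := bounded_linearPZ f 1 0 0; rewrite !scale1r addr0 => f0.
by apply: (addrI (f 0)); rewrite addr0 -f0.
Qed.

Lemma bounded_linearZ f a x : f (a *: x) = a *: f x.
Proof. by have := bounded_linearPZ f a x 0; rewrite bounded_linear0 !addr0. Qed.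

Lemma bounded_linearD f x y : f (x + y) = f x + f y.
Proof. by have := bounded_linearPZ f 1 x y; rewrite !scale1r. Qed.

Lemma bounded_linear_sum f (J : Type) (s : seq J) (F : J -> U) :
  f (\sum_(i <- s) F i) = \sum_(i <- s) f (F i).
Proof.
by apply: (big_morph f); [exact: bounded_linearD|exact: bounded_linear0].
Qed.

Lemma bounded_linear_exists (h : U -> V) (M : K) : linear h ->
  (forall x, `|h x| <= M * `|x|) -> exists f, f = h :> (U -> V).
Proof.
move=> lh hM; have hP : h \in @bounded_linear_pred K U V.
  by rewrite inE; split => //; exists M.
by exists (BoundedLinear hP).
Qed.

Lemma bounded_linear_ext f g : (forall x, f x = g x) -> f = g.
Proof. by move=> fg; apply: val_inj; apply/funext. Qed.

Lemma bounded_linear_addE f g x : (f + g) x = f x + g x.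
Proof. by []. Qed.

Lemma bounded_linear_scaleE a f x : (a *: f) x = a *: f x.
Proof. by []. Qed.

End bounded_linear_theory.

(* What the proof uses of the scalar field, so as to treat [R] and [R[i]] at
   once: [re] is the real part and [rho] the inclusion of [R]. *)
Record real_part (R : realType) (K : numFieldType) := RealPart {
  re : K -> R;
  rho : R -> K;
  reD : {morph re : x y / x + y};
  re_rhoM : forall a z, re (rho a * z) = a * re z;
  rho1 : rho 1 = 1;
  rhoD : {morph rho : x y / x + y};
  re_rho : cancel rho re;
  rho_le : forall a b, (rho a <= rho b) = (a <= b);
  rho_ge0 : forall z, 0 <= z -> exists a, z = rho a;
  re_le_norm : forall z, rho (re z) <= `|z|;
  disc_compact : forall a, compact [set z : K^o | `|z| <= rho a] }.

Section scalars.
Context {R : realType} {K : numFieldType} (rp : real_part R K).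
Local Notation re := (re rp).
Local Notation rho := (rho rp).

Lemma rho0 : rho 0 = 0.
Proof. by apply: (addrI (rho 0)); rewrite -rhoD !addr0. Qed.

Lemma re0 : re 0 = 0.
Proof. by apply: (addrI (re 0)); rewrite -reD !addr0. Qed.

Lemma rhoN a : rho (- a) = - rho a.
Proof. by apply: (addrI (rho a)); rewrite -rhoD !subrr rho0. Qed.

Lemma reN z : re (- z) = - re z.
Proof. by apply: (addrI (re z)); rewrite -reD !subrr re0. Qed.

Lemma rho_lt a b : (rho a < rho b) = (a < b).
Proof.
by rewrite !lt_def rho_le (inj_eq (can_inj (re_rho rp))).
Qed.

Lemma re_sum (J : Type) (s : seq J) (F : J -> K) :
  re (\sum_(i <- s) F i) = \sum_(i <- s) re (F i).
Proof. by apply: (big_morph re); [exact: reD|exact: re0]. Qed.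

Lemma re_normr (z : K) : rho (re `|z|) = `|z|.
Proof.
have [a ->] : exists a, `|z| = rho a by apply: rho_ge0.
by rewrite re_rho.
Qed.

(** [re] is 1-Lipschitz: [re_le_norm] is one-sided, so it is applied to [x - y] or to its opposite
    according to the sign of the real part. *)
Lemma re_continuous : continuous (re : K^o -> R^o).
Proof.
move=> x A /nbhs_ballP[e e0 eA]; apply/nbhs_ballP.
exists (rho e) => [|y xy]; first by rewrite /= -rho0 rho_lt.
apply: eA; rewrite /ball/= -reN -reD -rho_lt; apply: le_lt_trans xy.
have [r0|r0] := leP 0 (re (x - y)).
  by rewrite ger0_norm// re_le_norm.
by rewrite ltr0_norm// -reN -[leRHS]normrN re_le_norm.
Qed.

Lemma closed_disc (a : R) : closed [set z : K^o | `|z| <= rho a].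
Proof.
apply: compact_closed; first exact: norm_hausdorff.
exact: disc_compact.
Qed.

(** [supremum] selects a least upper bound only if one exists. Nonnegative scalars lie in the image
    of [rho], and so does any upper bound of [A]; hence the supremum taken in [R] can be
    transported. *)
Lemma supremum_isLub (A : set K) (M : K) : A !=set0 ->
  (forall z, A z -> 0 <= z <= M) -> supremums A (supremum 0 A).
Proof.
move=> A0 AM.
have Are z : A z -> z = rho (re z).
  by move=> /AM/andP[/(rho_ge0 rp)[a ->]]; rewrite re_rho.
have [z0 Az0] := A0.
have : supremums A (rho (sup (re @` A))).
  have supA : has_sup (re @` A).
    split; first exact: image_nonempty.
    exists (re M) => _ [z Az <-].
    have [a Ma] : exists a, M = rho a.
      by apply: rho_ge0; case/andP: (AM _ Az0); exact: le_trans.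
    by rewrite Ma re_rho -(rho_le rp) -Ma -Are//; case/andP: (AM _ Az).
  split=> [z Az|b bA].
    by rewrite (Are _ Az) rho_le; apply: sup_upper_bound => //; exists z.
  have [a ba] : exists a, b = rho a.
    apply: rho_ge0; apply: le_trans (bA _ Az0).
    by case/andP: (AM _ Az0).
  rewrite ba rho_le; apply: ge_sup; first exact: image_nonempty.
  by move=> _ [z Az <-]; rewrite -(rho_le rp) -ba -Are//; exact: bA.
rewrite /supremum ifF; last by apply/negbTE/set0P.
by move=> sA; exact: (xgetPex 0 (ex_intro _ _ sA)).
Qed.

Section opnorm_theory.
Context {U V : normedModType K}.
Implicit Types f : bounded_linear U V.

Lemma opnorm_isLub f :
  supremums [set `|f x| | x in [set x : U | `|x| <= 1]] (opnorm f).
Proof.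
have := bounded_linearP f; rewrite inE => -[_ [M fM]].
apply: (@supremum_isLub _ `|M|); first by exists `|f 0|, 0 => //=; rewrite normr0.
move=> _ [x /= x1 <-]; rewrite normr_ge0/=.
rewrite -[leLHS]ger0_norm//; apply: le_trans (_ : `|M * `|x| | <= _).
  rewrite !ger0_norm//; exact: le_trans (fM x).
by rewrite normrM normr_id ler_piMr.
Qed.

Lemma ler_opnorm f x : `|f x| <= opnorm f * `|x|.
Proof.
have [->|x0] := eqVneq x 0; first by rewrite bounded_linear0 !normr0 mulr0.
have nx : 0 < `|x| by rewrite normr_gt0.
have [ub _] := opnorm_isLub f; rewrite -ler_pdivrMr//.
apply: ub; exists (`|x|^-1 *: x) => /=.
  by rewrite normrZ normfV normr_id mulVf ?gt_eqF.
by rewrite bounded_linearZ normrZ normfV normr_id mulrC.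
Qed.

Lemma opnorm_le f C : 0 <= C -> (forall x, `|f x| <= C * `|x|) -> opnorm f <= C.
Proof.
move=> C0 fC; have [_ lb] := opnorm_isLub f; apply: lb => _ [x /= x1 <-].
by apply: le_trans (fC x) _; rewrite ler_piMr.
Qed.

Lemma opnorm_le1 f : opnorm f <= 1 <-> forall x, `|f x| <= `|x|.
Proof.
split=> [f1 x|f1]; last by apply: opnorm_le => // x; rewrite mul1r.
by apply: le_trans (ler_opnorm f x) _; rewrite ler_piMl.
Qed.

End opnorm_theory.
End scalars.

(** * The numerical radius as a least upper bound *)

Section numerical_radius_theory.
Context {R : realType} {K : numFieldType} (rp : real_part R K).
Context {X : normedModType K} (wN : is_norm (@numerical_radius K X)).
Hypothesis X0 : exists x : X, x != 0.

Let states (T : endo X) : set K := [set r | exists (f : dual X) (x : X),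
  [/\ opnorm f = 1, `|x| = 1, f x = 1 & r = `|f (T x)|]].

(* No support functionals have to be constructed: without any, [w] would vanish
   identically. *)
Lemma states_nonempty T : states T !=set0.
Proof.
have [x x0] := X0; have [_ _ wN0] := wN.
have [id1 id1E] : exists id1 : endo X, id1 = id :> (X -> X).
  by apply: (@bounded_linear_exists _ _ _ _ 1) => // y; rewrite mul1r.
have [s0|/set0P[_ [f [y [nf ny fy _]]]]] := eqVneq (states id1) set0.
  have w0 : numerical_radius id1 = 0.
    by rewrite /numerical_radius -/(states id1) s0 supremum0.
  by move: x0; rewrite -[x]/(id x) -id1E (wN0 _ w0) eqxx.
by exists `|f (T y)|, f, y.
Qed.

Lemma numerical_radius_isLub T : supremums (states T) (numerical_radius T).
Proof.
apply: (supremum_isLub rp (M := opnorm T)); first exact: states_nonempty.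
move=> _ [f [x [nf nx _ ->]]]; rewrite normr_ge0/=.
apply: le_trans (ler_opnorm rp f _) _; rewrite nf mul1r.
by apply: le_trans (ler_opnorm rp T _) _; rewrite nx mulr1.
Qed.

Lemma numerical_radius_le (T : endo X) C :
  (forall (f : dual X) x, opnorm f = 1 -> `|x| = 1 -> f x = 1 -> `|f (T x)| <= C) ->
  numerical_radius T <= C.
Proof.
move=> TC; have [_ lb] := numerical_radius_isLub T.
by apply: lb => _ [f [x [nf nx fx ->]]]; exact: TC.
Qed.

(** The relaxed conditions force [x] and [f] to have norm 1, and dividing [f] by the unimodular
    scalar [f x] gives a genuine state with the same modulus at [T x]. *)
Lemma numerical_radius_ge (T : endo X) (f : dual X) x :
  opnorm f <= 1 -> `|x| <= 1 -> `|f x| = 1 -> `|f (T x)| <= numerical_radius T.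
Proof.
move=> nf nx fx; have [ub _] := numerical_radius_isLub T.
have fx0 : f x != 0 by rewrite -normr_eq0 fx oner_neq0.
have x1 : `|x| = 1.
  by apply/eqP; rewrite eq_le nx -fx; move/(opnorm_le1 rp): nf; exact.
apply: ub; exists ((f x)^-1 *: f), x; split=> //.
- apply/eqP; rewrite eq_le; apply/andP; split.
    apply/(opnorm_le1 rp) => y.
    rewrite bounded_linear_scaleE normrZ normfV fx invr1 mul1r.
    by move/(opnorm_le1 rp): nf; exact.
  have := ler_opnorm rp ((f x)^-1 *: f) x.
  rewrite bounded_linear_scaleE normrZ normfV fx invr1 x1.
  by rewrite mul1r mulr1.
- by rewrite bounded_linear_scaleE; exact: mulVf.
- by rewrite bounded_linear_scaleE normrZ normfV fx invr1 mul1r.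
Qed.

End numerical_radius_theory.

(** * Bases and coordinates in finite dimension *)

Section finite_dimension.
Context {R : realType} {K : numFieldType} (rp : real_part R K).
Local Notation rho := (rho rp).

Definition basis (X : lmodType K) n (e : 'I_n -> X) :=
  (forall x, exists c : 'I_n -> K, x = \sum_(i < n) c i *: e i) /\
  (forall c : 'I_n -> K, \sum_(i < n) c i *: e i = 0 -> forall i, c i = 0).

(** A spanning family of least length is free: a relation with [c i != 0] would express [e i]
    through the other vectors, which would still span. *)
Lemma finite_dimensional_basis (X : lmodType K) : finite_dimensional X ->
  exists n (e : 'I_n -> X), basis e.
Proof.
move=> fX.
pose spans n := `[< exists e : 'I_n -> X,
  forall x, exists c : 'I_n -> K, x = \sum_(i < n) c i *: e i >].
have exn : exists n, spans n.
  by have [n [e eP]] := fX; exists n; apply/asboolP; exists e.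
case: (ex_minnP exn) => -[|n] /asboolP[e eX] nmin; exists _, e; split => // c c0 i.
  by case: i.
apply: contrapT => /eqP ci0.
suff /nmin : spans n by rewrite ltnn.
apply/asboolP; exists (e \o lift i) => x.
have [d ->] := eX x.
exists (fun j => d (lift i j) - d i / c i * c (lift i j)).
have ei : e i = - ((c i)^-1 *: \sum_(j < n) c (lift i j) *: e (lift i j)).
  apply/eqP; rewrite -addr_eq0; apply/eqP; apply: (scalerI ci0).
  by rewrite scalerDr scalerA divff// scale1r scaler0 -[RHS]c0 (bigD1_ord i).
rewrite (bigD1_ord i)//= {1}ei scalerN scalerA scaler_sumr -sumrN -big_split/=.
by apply: eq_bigr => j _; rewrite scalerBl scalerA addrC.
Qed.

Lemma basis_coordinates (X : lmodType K) n (e : 'I_n -> X) : basis e ->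
  exists l : 'I_n -> X -> K^o,
    (forall i, linear (l i)) /\ forall x, x = \sum_(i < n) l i x *: e i.
Proof.
move=> [gen free]; have [c cE] := choice gen.
exists (fun i x => c x i); split=> // i a x y.
apply/eqP; rewrite -subr_eq0; apply/eqP.
apply: (free (fun i => c (a *: x + y) i - (a * c x i + c y i))).
under eq_bigr do rewrite scalerBl scalerDl -scalerA.
by rewrite sumrB big_split/= -scaler_sumr -!cE subrr.
Qed.

Lemma lincomb_continuous (X : normedModType K) n (e : 'I_n -> X) :
  continuous (fun c : {ptws 'I_n -> K^o} => \sum_(i < n) c i *: e i).
Proof.
apply: continuous_big => [|i _]; first exact: add_continuous.
move=> c; apply: (@cvg_comp _ _ _ (fun f : {ptws 'I_n -> K^o} => f i)
  (fun z : K^o => z *: e i) (nbhs c) (nbhs (c i))).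
  exact: eval_continuous.
by apply: cvgZr_tmp; exact: cvg_id.
Qed.

(** The coefficient families with [c i = 1] and all moduli at most 1 form a compact set, whose image
    under [Phi] omits 0 by freeness; so [Phi] is bounded below there by some [m i]. Dividing by a
    coefficient of largest modulus reduces to this case, and the sum of the inverses of the [m i]
    covers all indices at once. *)
Lemma coordinates_bounded (X : normedModType K) n (e : 'I_n -> X) : basis e ->
  exists2 M, 0 <= M &
    forall c i, `|c i| <= M * `|\sum_(j < n) c j *: e j|.
Proof.
move=> [_ free].
pose Phi (c : {ptws 'I_n -> K^o}) : X := \sum_(j < n) c j *: e j.
have cPhi : continuous Phi by exact: lincomb_continuous.
have lower i : exists2 m : K, 0 < m & forall c : 'I_n -> K,
    c i = 1 -> (forall j, `|c j| <= 1) -> m <= `|Phi c|.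
  pose A j : set K^o := if j == i then [set 1] else [set z : K^o | `|z| <= rho 1].
  pose S : set {ptws 'I_n -> K^o} := [set c | forall j, A j (c j)].
  have kS : compact S.
    apply: (@tychonoff _ (fun=> K^o) A) => j; rewrite /A.
    case: eqP => _; first exact: compact_set1.
    exact: disc_compact.
  have : nbhs (0 : X) (~` (Phi @` S)).
    apply: open_nbhs_nbhs; split.
      apply: closed_openC; apply: compact_closed; first exact: norm_hausdorff.
      by apply: continuous_compact => //; exact: continuous_subspaceT.
    move=> [c Sc /free ci]; have := Sc i; rewrite /A eqxx ci => /esym/eqP.
    by rewrite oner_eq0.
  move=> /nbhs_ballP[m /= m0 mS]; exists m => // c ci c1.
  have mr : m \is Num.real by exact: gtr0_real.
  rewrite real_leNgt// ?normr_real//; apply/negP => cm.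
  apply: (mS (Phi c)); first by rewrite -ball_normE /= sub0r normrN.
  by exists c => // j; rewrite /A; case: eqP => [->//|_]; rewrite /= rho1.
pose m i := sval (cid2 (lower i)).
have m0 i : 0 < m i by rewrite /m; case: cid2.
have mP i c : c i = 1 -> (forall j, `|c j| <= 1) -> m i <= `|Phi c|.
  by rewrite /m; case: cid2 => ? ? /=; exact.
exists (\sum_i (m i)^-1); first by apply: sumr_ge0 => i _; rewrite invr_ge0 ltW.
move=> c i.
(* The maximum is taken over real parts because the order of [K] need not be total. *)
pose k := [arg max_(k > i) re rp `|c k|]%O.
have kP j : `|c j| <= `|c k|.
  rewrite -(re_normr rp) -[leRHS](re_normr rp) rho_le /k.
  by case: arg_maxP => // k0 _; exact.
apply: le_trans (kP i) _.
have [->|ck0] := eqVneq (c k) 0.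
  by rewrite normr0 mulr_ge0// sumr_ge0// => j _; rewrite invr_ge0 ltW.
have nck : 0 < `|c k| by rewrite normr_gt0.
apply: (@le_trans _ _ ((m k)^-1 * `|Phi c|)).
  rewrite ler_pdivlMl//.
  have := mP k (fun j => c j / c k); rewrite divff//.
  have -> : Phi (fun j => c j / c k) = (c k)^-1 *: Phi c.
    by rewrite scaler_sumr; apply: eq_bigr => j _; rewrite scalerA mulrC.
  rewrite normrZ normfV [_^-1 * _]mulrC ler_pdivlMr// => -> // j.
  by rewrite normrM normfV ler_pdivrMr// mul1r.
apply: ler_wpM2r => //; rewrite (bigD1 k)//= lerDl.
by apply: sumr_ge0 => j _; rewrite invr_ge0 ltW.
Qed.

Lemma finite_dimensional_bounded (X V : normedModType K) (h : X -> V) :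
  finite_dimensional X -> linear h ->
  exists f : bounded_linear X V, f = h :> (X -> V).
Proof.
move=> /finite_dimensional_basis[n [e be]] lh.
have [M M0 cM] := coordinates_bounded be.
apply: (@bounded_linear_exists _ _ _ _ (\sum_(i < n) M * `|h (e i)|)) => // x.
pose H : {linear X -> V} := HB.pack h (GRing.isLinear.Build _ _ _ _ _ lh).
have [c xE] := be.1 x; rewrite {1}xE.
rewrite -[h _]/(H _) linear_sum mulr_suml.
apply: le_trans (ler_norm_sum _ _ _) _; apply: ler_sum => i _.
by rewrite linearZ/= normrZ mulrAC ler_wpM2r// xE cM.
Qed.

End finite_dimension.

(** * Compact sets of functionals *)

(** Raw functions instead of elements of [dual V], so that the ball lies in a product space. *)
Definition dual_ball (K : numFieldType) (V : normedModType K) : set {ptws V -> K^o} :=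
  [set h | linear (h : V -> K^o) /\ forall x, `|h x| <= `|x|].

Definition re_dual_ball (R : realType) (K : numFieldType) (rp : real_part R K)
  (V : normedModType K) : set {ptws V -> R} :=
  [set d | exists2 f : dual V, opnorm f <= 1 & d = fun x => re rp (f x)].

(** These conditions, unlike [f x = 1], survive multiplying [f] by a unimodular scalar, and they cut
    out a closed set of pairs. *)
Definition re_tensors (R : realType) (K : numFieldType) (rp : real_part R K)
  (X : normedModType K) : set {ptws endo X -> R} :=
  [set d | exists (f : dual X) (x : X), [/\ opnorm f <= 1, `|x| <= 1, `|f x| = 1 &
    d = fun T => re rp (tensor f x T)]].

Arguments dual_ball {K} V _.
Arguments re_dual_ball {R K} rp V _.
Arguments re_tensors {R K} rp X _.

Section compactness.
Context {R : realType} {K : numFieldType} (rp : real_part R K).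
Local Notation re := (re rp).
Local Notation rho := (rho rp).

Lemma closed_norm_le1 (T : topologicalType) (V : normedModType K) (h : T -> V) :
  continuous h -> closed [set t | `|h t| <= 1].
Proof.
move=> ch.
have -> : [set t | `|h t| <= 1] =
    (fun t => `|h t| : K^o) @^-1` [set z : K^o | `|z| <= rho 1].
  by apply/seteqP; split => t /=; rewrite normr_id rho1.
apply: closed_comp; last exact: closed_disc.
by move=> t _; apply: cvg_norm; exact: ch.
Qed.

Lemma closed_eq_cst (T : topologicalType) (h : T -> K^o) (a : K) :
  continuous h -> closed [set t | h t = a].
Proof.
move=> ch; apply: (@closed_comp _ _ h [set a]) => [t _|]; first exact: ch.
apply: compact_closed; first exact: norm_hausdorff.
exact: compact_set1.
Qed.

Lemma closed_norm_eq1 (T : topologicalType) (V : normedModType K) (h : T -> V) :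
  continuous h -> closed [set t | `|h t| = 1].
Proof.
by move=> ch; apply: closed_eq_cst => t; apply: cvg_norm; exact: ch.
Qed.

(** Banach-Alaoglu: a product of discs of radius [|x|], cut by the closed equations expressing
    linearity. *)
Lemma compact_dual_ball (V : normedModType K) : compact (dual_ball V).
Proof.
have -> : dual_ball V = [set h : {ptws V -> K^o} | forall x, `|h x| <= `|x|] `&`
    \bigcap_p [set h : {ptws V -> K^o} |
      h (p.1.1 *: p.1.2 + p.2) - (p.1.1 * h p.1.2 + h p.2) = 0].
  apply/seteqP; split => h [].
    by move=> lh hb; split => // -[[a x] y] _ /=; rewrite lh subrr.
  move=> hb lh; split => // a x y.
  by apply/eqP; rewrite -subr_eq0; apply/eqP; exact: (lh ((a, x), y) I).
apply: compact_closedI.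
  apply: (@tychonoff V (fun=> K^o) (fun x => [set z : K^o | `|z| <= `|x|])) => x.
  have [a ->] : exists a, `|x| = rho a by apply: rho_ge0.
  exact: disc_compact.
apply: closed_bigI => -[[a x] y] _ /=; apply: closed_eq_cst.
apply: continuous_subr; first exact: eval_continuous.
apply: continuous_addr; last exact: eval_continuous.
apply: continuous_mulr; last exact: eval_continuous.
exact: cst_continuous.
Qed.

Lemma ptws_re_continuous (T : topologicalType) (J : choiceType)
  (h : T -> {ptws J -> K^o}) : continuous h ->
  continuous ((fun t => fun j => re (h t j)) : T -> {ptws J -> R}).
Proof.
move=> ch; apply: ptws_continuous => j t.
apply: (@cvg_comp _ _ _ (fun t => h t j) re (nbhs t) (nbhs (h t j))).
  apply: (@cvg_comp _ _ _ h (fun f : {ptws J -> K^o} => f j) (nbhs t) (nbhs (h t))).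
    exact: ch.
  exact: eval_continuous.
exact: re_continuous.
Qed.

Lemma compact_re_dual_ball (V : normedModType K) : compact (re_dual_ball rp V).
Proof.
have -> : re_dual_ball rp V =
    (fun h : {ptws V -> K^o} => (fun x => re (h x)) : {ptws V -> R}) @` dual_ball V.
  apply/seteqP; split => [_ [f /(opnorm_le1 rp) f1 ->]|_ [h [lh h1] <-]].
    by exists f => //; split => //; exact: bounded_linear_is_linear.
  have [|f fE] := @bounded_linear_exists _ _ K^o h 1 lh.
    by move=> x; rewrite mul1r.
  exists f; last by rewrite fE.
  by apply/(opnorm_le1 rp); rewrite fE.
apply: continuous_compact; last exact: compact_dual_ball.
by apply: continuous_subspaceT; apply: ptws_re_continuous => x; exact: cvg_id.
Qed.

Lemma convex_re_dual_ball (V : normedModType K) : convex (re_dual_ball rp V).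
Proof.
move=> t _ _ /andP[t0 t1] [f /(opnorm_le1 rp) f1 ->] [g /(opnorm_le1 rp) g1 ->].
exists (rho t *: f + rho (1 - t) *: g).
  apply/(opnorm_le1 rp) => x.
  rewrite bounded_linear_addE !bounded_linear_scaleE.
  apply: le_trans (ler_normD _ _) _; rewrite !normrZ.
  rewrite [`|rho t|]ger0_norm ?[`|rho (1 - t)|]ger0_norm -?(rho0 rp)
    ?rho_le ?subr_ge0//.
  have xE : `|x| = rho t * `|x| + rho (1 - t) * `|x|.
    by rewrite -mulrDl -rhoD addrC subrK rho1 mul1r.
  by rewrite [leRHS]xE lerD// ler_wpM2l// -(rho0 rp) rho_le ?subr_ge0.
apply/funext => x; rewrite /mix bounded_linear_addE !bounded_linear_scaleE reD.
by rewrite -!re_rhoM.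
Qed.

(** With [z = f x - g x], scaling [x] by [|z| / z] turns the difference of values into [|z|], which
    is determined by its real part. *)
Lemma re_linear_inj (V : normedModType K) (f g : dual V) :
  (forall x, re (f x) = re (g x)) -> f = g.
Proof.
move=> fg; apply: bounded_linear_ext => x; apply/eqP; rewrite -subr_eq0.
apply/negPn/negP => z0; have := fg ((`|f x - g x| / (f x - g x)) *: x).
rewrite !bounded_linearZ => /eqP; rewrite -subr_eq0 -(reN rp) -reD -scalerBr.
rewrite [_ *: _](divfK z0) => /eqP re0; move: z0.
by rewrite -normr_eq0 -(re_normr rp) re0 rho0 eqxx.
Qed.

End compactness.

Section tensors.
Context {R : realType} {K : numFieldType} (rp : real_part R K).
Context {X : normedModType K}.
Local Notation re := (re rp).
Local Notation rho := (rho rp).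

(** Writing [x] in coordinates turns [f (T x)] into the finite sum [pairing], jointly continuous in
    [f] and the coordinates for pointwise convergence. *)
Lemma compact_re_tensors : finite_dimensional X -> compact (re_tensors rp X).
Proof.
move=> /finite_dimensional_basis[n [e be]].
have [M M0 cM] := coordinates_bounded rp be.
have [m mE] : exists m, M = rho m by apply: rho_ge0.
pose F := {ptws X -> K^o}; pose C := {ptws 'I_n -> K^o}.
have ev1 x : continuous (fun p : F * C => p.1 x).
  move=> p; apply: (@cvg_comp _ _ _ fst (fun f : F => f x) (nbhs p) (nbhs p.1)).
    exact: cvg_fst.
  exact: eval_continuous.
have ev2 i : continuous (fun p : F * C => p.2 i).
  move=> p; apply: (@cvg_comp _ _ _ snd (fun f : C => f i) (nbhs p) (nbhs p.2)).
    exact: cvg_snd.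
  exact: eval_continuous.
pose pairing (T : X -> X) (p : F * C) : K^o := \sum_(i < n) p.2 i * p.1 (T (e i)).
have cpairing T : continuous (pairing T).
  apply: continuous_big => [|i _]; first exact: add_continuous.
  by apply: continuous_mulr; [exact: ev2|exact: ev1].
(* The bound [rho m] on the coordinates follows from [|x| <= 1] through [cM]; it is imposed to
   obtain compactness. *)
pose S : set (F * C) := (dual_ball X `*` [set c | forall i, `|c i| <= rho m]) `&`
  ([set p | `|\sum_(i < n) p.2 i *: e i| <= 1] `&`
   [set p | `|pairing id p| = 1]).
have kS : compact S.
  apply: compact_closedI.
    apply: compact_setX; first exact: (compact_dual_ball rp).
    apply: (@tychonoff _ (fun=> K^o) (fun=> [set z : K^o | `|z| <= rho m])) => _.
    exact: disc_compact.
  apply: closedI.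
    apply: (closed_norm_le1 rp) => p.
    apply: (@cvg_comp _ _ _ snd (fun c : C => \sum_(i < n) c i *: e i)
      (nbhs p) (nbhs p.2)); [exact: cvg_snd|exact: lincomb_continuous].
  exact: closed_norm_eq1 (cpairing id).
have pairingE (f : dual X) (T : endo X) (c : C) :
    pairing T ((f : X -> K^o), c) = f (T (\sum_(i < n) c i *: e i)).
  by rewrite 2!bounded_linear_sum; apply: eq_bigr => i _; rewrite !bounded_linearZ.
have -> : re_tensors rp X = (fun p => (fun T : endo X => re (pairing T p)) :
    {ptws endo X -> R}) @` S.
  have [id1 id1E] : exists id1 : endo X, id1 = id :> (X -> X).
    by apply: (@bounded_linear_exists _ _ _ _ 1) => // y; rewrite mul1r.
  apply/seteqP; split => [_ [f [x [/(opnorm_le1 rp) f1 x1 fx ->]]]|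
    _ [[h c] [[/= [lh h1] cm] [/= x1 hx]] <-]].
    have [c xE] := be.1 x; exists ((f : X -> K^o), c).
      split; split => /=.
      - by split => //; exact: bounded_linear_is_linear.
      - move=> i; rewrite -mE; apply: le_trans (cM c i) _.
        by rewrite -xE ler_piMr.
      - by rewrite -xE.
      - by rewrite -id1E pairingE -xE id1E.
    by apply/funext => T; rewrite pairingE -xE.
  have [|f fE] := @bounded_linear_exists _ _ K^o h 1 lh.
    by move=> x; rewrite mul1r.
  exists f, (\sum_(i < n) c i *: e i); split => //.
  - by apply/(opnorm_le1 rp); rewrite fE.
  - by rewrite -[X in f X]/(id _) -id1E -pairingE fE id1E.
  - by apply/funext => T; rewrite /tensor -pairingE fE.
apply: continuous_compact => //; apply: continuous_subspaceT.
apply: ptws_re_continuous; apply: ptws_continuous => T; exact: cpairing.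
Qed.

End tensors.

(** * Extreme functionals are tensors of extreme points *)

Section extreme_functionals.
Context {R : realType} {K : numFieldType} (rp : real_part R K).
Context {X : normedModType K} (wN : is_norm (@numerical_radius K X)).
Hypotheses (fX : finite_dimensional X) (X0 : exists x : X, x != 0).
Local Notation re := (re rp).
Local Notation rho := (rho rp).

Lemma exists_rotation (z : K) : exists2 u, `|u| = 1 & u * z = `|z|.
Proof.
have [->|z0] := eqVneq z 0; first by exists 1; rewrite ?normr1 ?mulr0 ?normr0.
exists (`|z| / z); last by rewrite divfK.
by rewrite normrM normfV normr_id divff// normr_eq0.
Qed.

(** The deficits [1 - |a|] and [1 - |b|] are nonnegative, and the triangle inequality makes their
    sum with positive weights at most 0. *)
Lemma unimodular_combination (a b t : K) : `|a| <= 1 -> `|b| <= 1 -> 0 < t < 1 ->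
  `|t * a + (1 - t) * b| = 1 -> `|a| = 1 /\ `|b| = 1.
Proof.
move=> a1 b1 /andP[t0 t1] abE.
have s0 : 0 < 1 - t by rewrite subr_gt0.
have : 1 <= t * `|a| + (1 - t) * `|b|.
  rewrite -[leLHS]abE; apply: le_trans (ler_normD _ _) _.
  by rewrite !normrM (gtr0_norm t0) (gtr0_norm s0).
have -> : t * `|a| + (1 - t) * `|b| =
  1 - (t * (1 - `|a|) + (1 - t) * (1 - `|b|)) by ring.
rewrite lerBrDl gerDr => h.
have ta : 0 <= t * (1 - `|a|) by rewrite mulr_ge0 ?subr_ge0// ltW.
have sb : 0 <= (1 - t) * (1 - `|b|) by rewrite mulr_ge0 ?subr_ge0// ltW.
have : t * (1 - `|a|) + (1 - t) * (1 - `|b|) == 0 by rewrite eq_le h addr_ge0.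
rewrite paddr_eq0// !mulf_eq0 (gt_eqF t0) (gt_eqF s0) /= !subr_eq0.
by move=> /andP[/eqP <- /eqP <-].
Qed.

Lemma tensor_in_dual_ball (f : dual X) x :
  opnorm f <= 1 -> `|x| <= 1 -> `|f x| = 1 ->
  exists2 psi : dual (endo_w wN), opnorm psi <= 1 & psi = tensor f x :> (endo X -> K).
Proof.
move=> f1 x1 fx.
have w_ge (T : endo_w wN) : `|tensor f x T| <= `|T|.
  exact: (numerical_radius_ge rp wN X0).
have [||psi psiE] := @bounded_linear_exists _ (endo_w wN) K^o (tensor f x) 1.
- by move=> a S T; exact: (bounded_linearPZ f a (S x) (T x)).
- by move=> T; rewrite mul1r; exact: w_ge.
exists psi => //; apply/(opnorm_le1 rp) => T; rewrite psiE; exact: w_ge.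
Qed.

(** Otherwise separation gives an operator [S] with [w(S) <= re (phi S) - e], while [phi] in the
    unit ball forces [re (phi S) <= w(S)]. *)
Lemma extreme_re_tensor (phi : dual (endo_w wN)) : dual_ball_extreme phi ->
  re_tensors rp X (fun T => re (phi T)).
Proof.
move=> [/= phi1 phi_ext]; apply: contrapT => nG.
pose E := {ptws endo_w wN -> R}.
have [||||t a b /andP[t0 t1] [f /= f1 ->] [g /= g1 ->] phiE|s [c [e [e0 sep]]]] :=
  @extreme_separation R (endo_w wN) (re_dual_ball rp (endo_w wN)) (re_tensors rp X)
  (fun T => re (phi T)) _ _ _ _ nG.
- exact: compact_re_dual_ball.
- exact: convex_re_dual_ball.
- exact: compact_re_tensors.
- move=> _ [f [x [f1 x1 fx ->]]].
  by have [psi psi1 psiE] := tensor_in_dual_ball f1 x1 fx;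
    exists psi => //; rewrite psiE.
- suff [-> _] : f = phi /\ g = phi by [].
  (* Extreme points are defined with weights in [K], so the real weight [t] enters as [rho t]. *)
  apply: (phi_ext f g (rho t)) => //.
    by rewrite -[X in X < _](rho0 rp) -(rho1 rp) !rho_lt t0.
  apply: (re_linear_inj (rp := rp)) => T.
  rewrite bounded_linear_addE !bounded_linear_scaleE reD.
  have -> : 1 - rho t = rho (1 - t) by rewrite rhoD rho1 rhoN.
  by rewrite !re_rhoM; exact: (congr1 (fun d : E => d T) phiE).
pose S : endo X := \sum_(T <- s) rho (c T) *: (T : endo X).
have reS (psi : dual (endo_w wN)) :
    re (psi S) = \sum_(T <- s) c T * re (psi T).
  rewrite /S bounded_linear_sum re_sum; apply: eq_bigr => T _.
  by rewrite bounded_linearZ re_rhoM.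
have wS : numerical_radius S <= rho (re (phi S) - e).
  apply: (numerical_radius_le rp wN X0) => f x f1 x1 fx.
  (* Separation controls real parts only; rotating [f] by [u] makes the value at [S x] equal to its
     modulus. *)
  have [u u1 uE] := exists_rotation (f (S x)).
  have uf1 : opnorm (u *: f) <= 1.
    apply/(opnorm_le1 rp) => y.
    rewrite bounded_linear_scaleE normrZ u1 mul1r.
    by apply: (opnorm_le1 rp f).1; rewrite f1.
  have ufx : `|(u *: f) x| = 1.
    by rewrite bounded_linear_scaleE normrZ u1 fx normr1 mulr1.
  have x1' : `|x| <= 1 by rewrite x1.
  have [psi _ psiE] := tensor_in_dual_ball uf1 x1' ufx.
  have : re_tensors rp X (fun T => re (psi T)).
    by exists (u *: f), x; split => //; rewrite psiE.
  move=> /sep; rewrite -!reS psiE /tensor bounded_linear_scaleE [_ *: _]uE.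
  by move=> h; rewrite -(re_normr rp) rho_le lerBrDr.
have := le_trans (re_le_norm rp (phi S)) (le_trans ((opnorm_le1 rp phi).1 phi1 S) wS).
by rewrite rho_le lerBrDl gerDr leNgt e0.
Qed.

(* Extremality of the factors of [f \otimes x]: if [x = t y + (1 - t) z] then
   [f y] and [f z] have modulus 1, so that [f \otimes y] and [f \otimes z] lie in
   the dual ball and must agree with [f \otimes x]; likewise for [f]. *)
Lemma extreme_functional_tensor (phi : dual (endo_w wN)) : dual_ball_extreme phi ->
  exists (f : dual X) (x : X), [/\ dual_ball_extreme f, ball_extreme x, `|f x| = 1 &
    phi = tensor f x :> (endo X -> K)].
Proof.
move=> phi_extr; have [f [x [f1 x1 fx phiE]]] := extreme_re_tensor phi_extr.
have [psi psi1 psiE] := tensor_in_dual_ball f1 x1 fx.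
have {}phiE : phi = tensor f x :> (endo X -> K).
  rewrite -psiE; suff -> : phi = psi by [].
  apply: (re_linear_inj (rp := rp)) => T; rewrite psiE.
  exact: (congr1 (fun d : endo X -> R => d T) phiE).
have [phi1 phi_ext] := phi_extr.
(* Both factors vary here, so that it serves with [y = z = x] for the extremality of [f] and with
   [g = h = f] for that of [x]. *)
have tensor_ext (g h : dual X) y z t : opnorm g <= 1 -> `|y| <= 1 ->
    opnorm h <= 1 -> `|z| <= 1 -> 0 < t < 1 ->
    (forall T, tensor f x T = t * tensor g y T + (1 - t) * tensor h z T) ->
    f x = t * g y + (1 - t) * h z ->
    (forall T, tensor g y T = tensor f x T) /\ (forall T, tensor h z T = tensor f x T).
  move=> g1 y1 h1 z1 t01 tE fxE.
  have gy : `|g y| <= 1 by apply: le_trans ((opnorm_le1 rp g).1 g1 y) y1.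
  have hz : `|h z| <= 1 by apply: le_trans ((opnorm_le1 rp h).1 h1 z) z1.
  have [gy1 hz1] : `|g y| = 1 /\ `|h z| = 1.
    by apply: unimodular_combination gy hz t01 _; rewrite -fxE.
  have [a a1 aE] := tensor_in_dual_ball g1 y1 gy1.
  have [b b1 bE] := tensor_in_dual_ball h1 z1 hz1.
  have [|ap bp] := phi_ext a b t a1 b1 t01.
    apply: bounded_linear_ext => T; rewrite bounded_linear_addE.
    by rewrite !bounded_linear_scaleE phiE aE bE tE.
  by split=> T; [rewrite -aE ap phiE|rewrite -bE bp phiE].
exists f, x; split => //; split => //.
- move=> g h t g1 h1 t01 fE.
  have fE' v : f v = t * g v + (1 - t) * h v by rewrite fE.
  have [|gf hf] := tensor_ext g h x x t g1 x1 h1 x1 t01 _ (fE' x).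
    by move=> T; rewrite /tensor fE'.
  have dual_eq (k : dual X) : (forall T, tensor k x T = tensor f x T) -> k = f.
    move=> kf; apply: bounded_linear_ext => v.
    (* This rank-one operator sends [x] to [v], so equality of the tensors at [T] reads
       [k v = f v]. *)
    have [T TE] : exists T : endo X, T = (fun w => (f x)^-1 *: (f w *: v)) :> (X -> X).
      apply: (finite_dimensional_bounded rp fX) => a w w'.
      rewrite bounded_linearPZ scalerDl scalerDr !scalerA; congr (_ *: _ + _).
      by rewrite -[a *: f w]/(a * f w) mulrCA mulrA.
    have := kf T; rewrite /tensor TE scalerA mulVf ?scale1r//.
    by rewrite -normr_eq0 fx oner_neq0.
  by split; exact: dual_eq.
- move=> y z t y1 z1 t01 xE.
  have fE (T : endo X) : f (T x) = t * f (T y) + (1 - t) * f (T z).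
    by rewrite xE !(bounded_linearD, bounded_linearZ).
  have [|yx zx] := tensor_ext f f y z t f1 y1 f1 z1 t01 fE.
    by rewrite xE !(bounded_linearD, bounded_linearZ).
  have point_eq w : (forall T, tensor f w T = tensor f x T) -> w = x.
    move=> wx; have [n [e be]] := finite_dimensional_basis fX.
    have [l [ll lE]] := basis_coordinates be.
    rewrite [w]lE [RHS]lE; apply: eq_bigr => i _; congr (_ *: _).
    (* At this operator the tensors take the values [l i w * f x] and [l i x * f x]; cancelling
       [f x] compares the coordinates. *)
    have [T TE] : exists T : endo X, T = (fun v => l i v *: x) :> (X -> X).
      apply: (finite_dimensional_bounded rp fX) => a v v'.
      by rewrite ll scalerDl scalerA.
    have := wx T; rewrite /tensor TE !bounded_linearZ; apply: mulIf.
    by rewrite -normr_eq0 fx oner_neq0.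
  by split; exact: point_eq.
Qed.

End extreme_functionals.

(** * The real and complex scalar fields *)

Section instances.
Variable R : realType.

Lemma real_part_real : real_part R R.
Proof.
apply: (@RealPart R R id id) => //.
- by move=> z _; exists z.
- by move=> z; exact: ler_norm.
- move=> a; rewrite (_ : [set z : R^o | `|z| <= a] = `[- a, a]%classic).
    exact: segment_compact.
  by apply/seteqP; split => z /=; rewrite in_itv/= ler_norml.
Qed.

(** The disc is the image under [toC] of a closed part of a compact square in [R * R]. *)
Lemma complex_disc_compact (a : R) : compact [set z : R[i]^o | `|z| <= a%:C%C].
Proof.
pose toC (p : R * R) : R[i]^o := (p.1 +i* p.2)%C.
pose N (p : R * R) := Num.sqrt (p.1 * p.1 + p.2 * p.2).
have normE p : `|toC p| = (N p)%:C%C by rewrite normc_def /= !expr2.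
have N_ge (p : R * R) : `|p.1| <= N p /\ `|p.2| <= N p.
  by split; rewrite -sqrtr_sqr ler_wsqrtr// expr2 ?lerDl ?lerDr -expr2 sqr_ge0.
have N_le (p : R * R) : N p <= `|p.1| + `|p.2|.
  rewrite -[leRHS]ger0_norm ?addr_ge0// -sqrtr_sqr ler_wsqrtr//.
  rewrite -!expr2 sqrrD !real_normK ?num_real// lerD2r lerDl mulrn_wge0//.
  by rewrite mulr_ge0.
have toC_continuous : continuous toC.
  move=> [x y] A /nbhs_ballP[e e0 eA].
  have [r r0 re] : exists2 r : R, 0 < r & e = r%:C%C.
    exists (complex.Re e); first by move: e0; rewrite /= ltcE => /andP[].
    by rewrite RRe_real// gtr0_real.
  (* Balls of [R * R] are squares and [N_le] bounds the modulus by the sum of two coordinates, hence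
     half the radius. *)
  apply/nbhs_ballP; exists (r / 2) => [|[x' y'] [/= xx' yy']].
    by rewrite /= divr_gt0.
  apply: eA; rewrite /ball/= re -[_ - _]/(toC (x - x', y - y')) normE ltcR.
  apply: le_lt_trans (N_le _) _; rewrite [ltRHS]splitr.
  exact: ltrD.
have -> : [set z : R[i]^o | `|z| <= a%:C%C] =
    toC @` ((`[- a, a]%classic `*` `[- a, a]%classic) `&` [set p | N p <= a]).
  apply/seteqP; split => [[x y]|_ [p [_ /= Np] <-]] /=; last by rewrite normE lecR.
  rewrite -[(x +i* y)%C]/(toC (x, y)) normE lecR => Na; exists (x, y) => //.
  have [Nx Ny] := N_ge (x, y).
  by split => //; split; rewrite /= in_itv/= -ler_norml; exact: le_trans Na.
apply: continuous_compact; first exact: continuous_subspaceT.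
apply: compact_closedI; first by apply: compact_setX; exact: segment_compact.
apply: (@closed_comp _ _ N [set x | x <= a]); last exact: closed_le.
move=> p _; apply: (@cvg_comp _ _ _ (fun p : R * R => p.1 * p.1 + p.2 * p.2)
  Num.sqrt (nbhs p) (nbhs (p.1 * p.1 + p.2 * p.2))); last exact: sqrt_continuous.
by apply: cvgD; apply: cvgM; (exact: cvg_fst || exact: cvg_snd).
Qed.

Lemma real_part_complex : real_part R R[i].
Proof.
apply: (@RealPart R R[i] (@complex.Re R) (real_complex R)) => //.
- by move=> [a b] [c d].
- by move=> a [c d]; rewrite /= mul0r subr0.
- by move=> x y; rewrite rmorphD.
- by move=> x y; exact: lecR.
- by move=> z z0; exists (complex.Re z); rewrite RRe_real// ger0_real.
- move=> z; apply: le_trans (normc_ge_Re z); rewrite lecR; exact: ler_norm.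
- exact: complex_disc_compact.
Qed.

End instances.

Theorem theorem2p3 (R : realType) :
  (forall (X : completeNormedModType R)
      (wN : is_norm (@numerical_radius R X)),
    finite_dimensional X -> (exists x : X, x != 0) ->
    forall phi : dual (endo_w wN), dual_ball_extreme phi ->
    exists (f : dual X) (x : X),
      [/\ dual_ball_extreme f, ball_extreme x, `|f x| = 1 &
          phi = tensor f x :> (endo X -> R)]) /\
  (forall (X : completeNormedModType R[i])
      (wN : is_norm (@numerical_radius R[i] X)),
    finite_dimensional X -> (exists x : X, x != 0) ->
    forall phi : dual (endo_w wN), dual_ball_extreme phi ->
    exists (f : dual X) (x : X),
      [/\ dual_ball_extreme f, ball_extreme x, `|f x| = 1 &
          phi = tensor f x :> (endo X -> R[i])]).
Proof.
split=> X wN fX X0 phi phi_extr.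
  exact: (extreme_functional_tensor (real_part_real R) fX X0 phi_extr).
exact: (extreme_functional_tensor (real_part_complex R) fX X0 phi_extr).
Qed.
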